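(* Let $V:=\mathbb{C}$ and let $G:=\langle e^{2\pi i/r}\rangle\leq U(1)$ for some $r\in\mathbb{N}=\{1,2,\ldots\}$, acting on $V$ by multiplication. Then $c_2(V/G)=r\sin\left(\frac{\pi}{2r}\right)$.
   Context: $V/G$ is the set of orbits $[x]=G\cdot x$, $x\in\mathbb{C}$, with metric $d([x],[y])=\min_{g\in G}|gx-y|$. The Euclidean distortion $c_2(X)\in[1,\infty]$ of a metric space $X$ is the infimum of all $c$ for which there exist a Hilbert space $H$, a map $f\colon X\to H$ and a constant $\alpha>0$ such that $\alpha\, d_X(x,x')\leq\|f(x)-f(x')\|\leq c\,\alpha\, d_X(x,x')$ for all $x,x'\in X$ (that is, $f$ is bilipschitz of distortion at most $c$, where distortion is the ratio of the optimal upper to lower Lipschitz bounds). *)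

(* Defs.v *)
From HB Require Import structures.
From mathcomp Require Import all_boot all_order all_algebra.
From mathcomp Require Import all_classical all_reals all_analysis.
From mathcomp Require Import complex ring.

Set Implicit Arguments.
Unset Strict Implicit.
Unset Printing Implicit Defensive.

Import Order.TTheory GRing.Theory Num.Theory.
Import Normc.
Import numFieldNormedType.Exports.

Local Open Scope classical_set_scope.
Local Open Scope ring_scope.

(* Hilbert spaces are taken over the reals.  A complex Hilbert space is also a
   real one, with the real part of its inner product and the same norm, so
   allowing complex scalars would not change the value of [c2] below. *)
Definition is_hilbert (R : realType) (H : completeNormedModType R) : Prop :=
  exists ip : {dot H for @idfun R}, forall x : H, `|x| ^+ 2 = ip x x.

Definition embeds_with_distortion (R : realType) (X : metricType R) (c : R) :
    Prop :=
  exists H : completeNormedModType R, is_hilbert H /\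
  exists (f : X -> H) (alpha : R), 0 < alpha /\
    forall x x' : X,
      alpha * mdist x x' <= `|f x - f x'| /\
      `|f x - f x'| <= c * alpha * mdist x x'.

(* The restriction [1 <= c] only matters for spaces with at most one point,
   where it makes the value 1; the infimum over the empty set is [+oo]. *)
Definition c2 (R : realType) (X : metricType R) : \bar R :=
  ereal_inf [set c%:E | c in
    [set c : R | 1 <= c /\ embeds_with_distortion X c]].

Section OrbitSpace.
Variables (R : realType) (r : nat).
Implicit Types (x y g h : R[i]).

(* exp(2 * pi * i / r) *)
Definition zeta : R[i] :=
  Complex (cos (2 * pi / r%:R)) (sin (2 * pi / r%:R)).

Definition rotation_group : set R[i] := range (fun k : int => zeta ^ k).

Definition rot_orbit x : set R[i] := [set g * x | g in rotation_group].

Definition orbit_space : Type := set_type (range rot_orbit).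

Definition orbit_class x : orbit_space := SigSub (mem_set (imageT rot_orbit x)).

Definition orbit_repr (A : orbit_space) : R[i] := sval (cid2 (set_valP A)).

(* The value does not depend on the representatives, and the infimum is a
   minimum: see [orbit_dist_class] and [orbit_dist_min]. *)
Definition orbit_dist (A B : orbit_space) : R :=
  inf [set normc (g * orbit_repr A - orbit_repr B) | g in rotation_group].

Lemma zetaX n : zeta ^+ n =
  Complex (cos (n%:R * (2 * pi / r%:R))) (sin (n%:R * (2 * pi / r%:R))).
Proof.
elim: n => [|n IHn]; first by rewrite expr0 mul0r cos0 sin0.
rewrite exprS IHn -(natr1 n) (mulrDl n%:R) mul1r cosD sinD /zeta.
by apply/eqP; rewrite eq_complex /=; apply/andP; split; apply/eqP; ring.
Qed.

Lemma normc_zeta : normc zeta = 1.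
Proof. by rewrite /= cos2Dsin2 sqrtr1. Qed.

Lemma zeta_neq0 : zeta != 0.
Proof.
apply/eqP => z0; have := normc_zeta; rewrite z0 normc0 => /eqP.
by rewrite eq_sym oner_eq0.
Qed.

Lemma zeta_order : exists2 n : nat, (0 < n)%N & zeta ^+ n = 1.
Proof.
case: (posnP r) => [r0|r_gt0].
  exists 1%N => //; rewrite zetaX r0 invr0 !mulr0.
  by rewrite cos0 sin0.
exists r => //; rewrite zetaX mulrC divfK ?pnatr_eq0 -?lt0n//.
by rewrite mulr_natl cos2pi sin2pi.
Qed.

Lemma normcX x n : normc (x ^+ n) = normc x ^+ n.
Proof.
by elim: n => [|n IHn]; [rewrite !expr0 normc1|rewrite !exprS normcM IHn].
Qed.

Lemma rot1 : rotation_group 1.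
Proof. by exists 0. Qed.

Lemma rotM g h : rotation_group g -> rotation_group h -> rotation_group (g * h).
Proof.
move=> [k _ <-] [l _ <-]; exists (k + l) => //.
by rewrite expfzDr// zeta_neq0.
Qed.

Lemma rotV g : rotation_group g -> rotation_group g^-1.
Proof. by move=> [k _ <-]; exists (- k) => //; rewrite -invr_expz. Qed.

Lemma rot_neq0 g : rotation_group g -> g != 0.
Proof. by move=> [k _ <-]; rewrite expfz_neq0// zeta_neq0. Qed.

Lemma normc_rot g : rotation_group g -> normc g = 1.
Proof.
move=> [k _ <-]; case: k => n; last rewrite NegzE -exprnN normcV.
  by rewrite -exprnP normcX normc_zeta expr1n.
by rewrite normcX normc_zeta expr1n invr1.
Qed.

Lemma rot_finite :
  exists n : nat, forall g, rotation_group g ->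
    exists k : 'I_n.+1, g = zeta ^+ k.
Proof.
have [[//|n] _ zn] := zeta_order; exists n => g [k _ <-].
have m0 : 0 <= (k %% n.+1%:Z)%Z by rewrite modz_ge0.
have mn : (k %% n.+1%:Z)%Z < n.+1%:Z by rewrite ltz_pmod.
have [m mE] : exists m : nat, (k %% n.+1%:Z)%Z = m.
  by exists `|(k %% n.+1%:Z)%Z|%N; rewrite gez0_abs.
have mlt : (m < n.+1)%N by move: mn; rewrite mE ltz_nat.
exists (Ordinal mlt) => /=.
have kE : k = n.+1%:Z * (k %/ n.+1%:Z)%Z + m by rewrite -mE mulrC -divz_eq.
by rewrite kE expfzDr ?zeta_neq0// -exprz_exp -exprnP zn exp1rz mul1r.
Qed.

Lemma rot_min x y : exists2 g, rotation_group g &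
  forall h, rotation_group h -> normc (g * x - y) <= normc (h * x - y).
Proof.
have [n nP] := rot_finite.
pose F (k : 'I_n.+1) := normc (zeta ^+ k * x - y).
case: (@Order.TotalTheory.arg_minP _ _ _ ord0 xpredT F isT) => k _ kP.
exists (zeta ^+ k); first by exists k%:Z.
by move=> h /nP[l ->]; exact: kP.
Qed.

Lemma inf_rot_min x y g : rotation_group g ->
    (forall h, rotation_group h -> normc (g * x - y) <= normc (h * x - y)) ->
  inf [set normc (h * x - y) | h in rotation_group] = normc (g * x - y).
Proof.
move=> Gg gP; apply/eqP; rewrite eq_le; apply/andP; split.
  apply: ge_inf; last by exists g.
  by exists (normc (g * x - y)) => _ [h Gh <-]; exact: gP.
apply: lb_le_inf; first by exists (normc (g * x - y)), g.
by move=> _ [h Gh <-]; exact: gP.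
Qed.

Lemma rot_orbitP x y :
  rot_orbit x = rot_orbit y <-> exists2 g, rotation_group g & y = g * x.
Proof.
split=> [xy|[g Gg ->]].
  have [g Gg gx] : rot_orbit x y.
    by rewrite xy; exists 1; [exact: rot1|rewrite mul1r].
  by exists g.
apply/seteqP; split=> _ [h Gh <-].
  exists (h * g^-1); first by apply: rotM => //; exact: rotV.
  by rewrite mulrA divfK// rot_neq0.
by exists (h * g); [exact: rotM|rewrite mulrA].
Qed.

Lemma orbit_reprK A : orbit_class (orbit_repr A) = A.
Proof. by apply: val_inj => /=; rewrite /orbit_repr; case: cid2. Qed.

Lemma orbit_classP x y :
  orbit_class x = orbit_class y <-> exists2 g, rotation_group g & y = g * x.
Proof.
rewrite -rot_orbitP; split=> [/(congr1 val)//|xy].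
exact: val_inj.
Qed.

Lemma orbit_dist_class x y : orbit_dist (orbit_class x) (orbit_class y) =
  inf [set normc (g * x - y) | g in rotation_group].
Proof.
rewrite /orbit_dist.
have /orbit_classP[a Ga aE] := esym (orbit_reprK (orbit_class x)).
have /orbit_classP[b Gb bE] := esym (orbit_reprK (orbit_class y)).
have nE g : normc (g * (a * x) - b * y) = normc (b^-1 * g * a * x - y).
  rewrite -[RHS]mul1r -(normc_rot Gb) -normcM; congr normc.
  by rewrite mulrBr !mulrA mulfV ?rot_neq0// mul1r.
rewrite aE bE; congr inf; apply/seteqP; split=> _ [g Gg <-].
  exists (b^-1 * g * a); last by rewrite nE.
  by apply: rotM => //; apply: rotM => //; exact: rotV.
exists (b * g * a^-1).
  by apply: rotM; [exact: rotM|exact: rotV].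
rewrite nE !mulrA mulVf ?rot_neq0// mul1r -(mulrA g) mulVf ?rot_neq0//.
by rewrite mulr1.
Qed.

Lemma orbit_dist_min x y : exists2 g, rotation_group g &
  orbit_dist (orbit_class x) (orbit_class y) = normc (g * x - y) /\
  forall h, rotation_group h -> normc (g * x - y) <= normc (h * x - y).
Proof.
have [g Gg gP] := rot_min x y; exists g => //; split=> //.
by rewrite orbit_dist_class (inf_rot_min Gg).
Qed.

Lemma orbit_dist_le x y g : rotation_group g ->
  orbit_dist (orbit_class x) (orbit_class y) <= normc (g * x - y).
Proof. by move=> Gg; have [h _ [-> hP]] := orbit_dist_min x y; exact: hP. Qed.

Lemma orbit_distxx A : orbit_dist A A = 0.
Proof.
rewrite -(orbit_reprK A); set x := orbit_repr A.
have [g _ [gE _]] := orbit_dist_min x x; apply/eqP; rewrite eq_le.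
apply/andP; split.
  by have := orbit_dist_le x x rot1; rewrite mul1r subrr normc0.
by rewrite gE; case: (g * x - x) => a b /=; exact: sqrtr_ge0.
Qed.

Lemma orbit_dist_positivity A B : orbit_dist A B = 0 -> A = B.
Proof.
rewrite -(orbit_reprK A) -(orbit_reprK B).
have [g Gg [-> _]] := orbit_dist_min (orbit_repr A) (orbit_repr B).
move=> /eq0_normc/eqP; rewrite subr_eq0 => /eqP gE.
by apply/orbit_classP; exists g.
Qed.

Lemma orbit_dist_sym A B : orbit_dist A B = orbit_dist B A.
Proof.
rewrite -(orbit_reprK A) -(orbit_reprK B).
set x := orbit_repr A; set y := orbit_repr B.
suff le u v : orbit_dist (orbit_class u) (orbit_class v) <=
    orbit_dist (orbit_class v) (orbit_class u) by apply/eqP; rewrite eq_le !le.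
have [g Gg [-> _]] := orbit_dist_min v u.
apply: le_trans (orbit_dist_le u v (rotV Gg)) _.
rewrite -[leRHS]mul1r -(normc_rot (rotV Gg)) -normcM mulrBr mulrA.
by rewrite mulVf ?rot_neq0// mul1r -normcN opprB.
Qed.

Lemma orbit_dist_triangle B A C :
  orbit_dist A C <= orbit_dist A B + orbit_dist B C.
Proof.
rewrite -(orbit_reprK A) -(orbit_reprK B) -(orbit_reprK C).
set x := orbit_repr A; set y := orbit_repr B; set z := orbit_repr C.
have [g Gg [-> _]] := orbit_dist_min x y.
have [h Gh [-> _]] := orbit_dist_min y z.
apply: le_trans (orbit_dist_le x z (rotM Gh Gg)) _.
have -> : h * g * x - z = h * (g * x - y) + (h * y - z) by ring.
apply: le_trans (le_normcD _ _) _.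
by rewrite normcM (normc_rot Gh) mul1r.
Qed.

HB.instance Definition _ :=
  Choice.copy orbit_space (set_type (range rot_orbit)).

HB.instance Definition _ := isMetric.Build R orbit_space
  orbit_distxx orbit_dist_positivity orbit_dist_sym orbit_dist_triangle.

End OrbitSpace.

(* Main.v *)
(* Lower bound.  On the circle [rho = 1] of the cone [V / G], of length
   [2 * pi / r], take [2 * m] equally spaced points.  For a map [F] into a
   Hilbert space the antipodal differences [F (j + m) - F j] are antiperiodic,
   so the Poincare inequality bounds them by the differences of consecutive
   points; the distortion is then at least
   [r * sin (pi / (2 * r)) * cos (pi / (2 * m))], and [m] tends to infinity.

   Upper bound.  The map [rho * e^(i t) |-> (rho * e^(i r t) / r,
   rho * sqrt (1 - 1 / r^2))] into 3-dimensional Euclidean space is 1-Lipschitz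
   and contracts by at most [r * sin (pi / (2 * r))].

   Both halves compare [sin (r * s)] with [sin s] through the Dirichlet kernel,
   which is at most [r] and decreases on [0, pi / r]. *)
Require Import Defs.
From HB Require Import structures.
From mathcomp Require Import all_boot all_order all_algebra.
From mathcomp Require Import all_classical all_reals all_analysis.
From mathcomp Require Import complex ring lra.
Import Order.TTheory GRing.Theory Num.Theory.
Import Normc.
Import numFieldNormedType.Exports.
Local Open Scope classical_set_scope.
Local Open Scope ring_scope.

(** * Real inner products and the Cauchy-Schwarz inequality *)

Section DotTheory.
Context {R : realType} {U : lmodType R} (ip : {dot U for @idfun R}).
Implicit Types (u v w : U) (a : R).

Lemma dotC u v : ip u v = ip v u.
Proof. by rewrite [LHS]hermC expr0 mul1r. Qed.

Lemma dotDl u v w : ip (u + v) w = ip u w + ip v w.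
Proof. exact: linearDl. Qed.

Lemma dotZl a u v : ip (a *: u) v = a * ip u v.
Proof. exact: linearZl_LR. Qed.

Lemma dotDr u v w : ip u (v + w) = ip u v + ip u w.
Proof. by rewrite dotC dotDl !(dotC u). Qed.

Lemma dotZr a u v : ip u (a *: v) = a * ip u v.
Proof. by rewrite dotC dotZl dotC. Qed.

Lemma dotNl u v : ip (- u) v = - ip u v.
Proof. by rewrite -scaleN1r dotZl mulN1r. Qed.

Lemma dotNr u v : ip u (- v) = - ip u v.
Proof. by rewrite dotC dotNl dotC. Qed.

Lemma dot0l v : ip 0 v = 0.
Proof. by rewrite -(scale0r 0) dotZl mul0r. Qed.

Lemma dot_ge0 u : 0 <= ip u u.
Proof.
have [->|u0] := eqVneq u 0; first by rewrite dot0l.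
exact/ltW/neq0_dnorm_gt0.
Qed.

Lemma dot_eq0 u : ip u u = 0 -> u = 0.
Proof.
move=> uu0; have [//|/(neq0_dnorm_gt0 (s := ip))] := eqVneq u 0.
by rewrite uu0 ltxx.
Qed.

(** The vector [ip v v *: u - ip u v *: v] has squared length [ip v v] times the difference of the
    two sides. *)
Lemma dot_cauchy_schwarz u v : ip u v ^+ 2 <= ip u u * ip v v.
Proof.
have [->|v0] := eqVneq v 0.
  by rewrite (dotC u) !dot0l expr0n mulr0.
have vv0 : 0 < ip v v by exact: neq0_dnorm_gt0.
have := dot_ge0 (ip v v *: u - ip u v *: v).
rewrite !(dotDl, dotDr, dotZl, dotZr, dotNl, dotNr) (dotC v u).
set x := ip u v; set y := ip u u; set z := ip v v in vv0 * => H.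
rewrite -(ler_pM2l vv0) -subr_ge0; apply: le_trans H _.
by rewrite le_eqVlt; apply/orP; left; apply/eqP; ring.
Qed.

End DotTheory.

(** * Euclidean space as a Hilbert space *)

Section Euclidean.
Context {R : realType} (n : nat).

Definition euclidean : Type := 'rV[R]_n.

HB.instance Definition _ := GRing.Lmodule.copy euclidean 'rV[R]_n.

Definition euclidean_dot (u v : euclidean) : R := \sum_i u 0 i * v 0 i.

Lemma euclidean_dot_bilinear :
  bilinear_for
    (GRing.Scale.Law.clone _ _ *%R _)
    (GRing.Scale.Law.clone _ _ (@idfun R \; *%R) _) euclidean_dot.
Proof.
split=> [w|w] a u v; rewrite /euclidean_dot /= mulr_sumr -big_split/=;
  apply: eq_bigr => i _; rewrite !mxE; ring.
Qed.

HB.instance Definition _ := @bilinear_isBilinear.Build R euclidean euclidean R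
  *%R (@idfun R \; *%R) euclidean_dot euclidean_dot_bilinear.

Lemma euclidean_dot_sym (u v : euclidean) :
  euclidean_dot u v = (-1) ^+ false * @idfun R (euclidean_dot v u).
Proof. by rewrite expr0 mul1r; apply: eq_bigr => i _; rewrite mulrC. Qed.

HB.instance Definition _ := @isHermitianSesquilinear.Build R euclidean false
  (@idfun R) euclidean_dot euclidean_dot_sym.

Lemma euclidean_dot_gt0 (u : euclidean) : u != 0 -> 0 < euclidean_dot u u.
Proof.
apply: contraNT; rewrite -leNgt => uu0; apply/eqP/rowP => i; rewrite mxE.
have sq0 j : true -> 0 <= u 0 j * u 0 j by rewrite -expr2 sqr_ge0.
have /psumr_eq0P/(_ i isT)/eqP : \sum_j u 0 j * u 0 j = 0.
  by apply/eqP; rewrite eq_le uu0 sumr_ge0.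
by rewrite mulf_eq0 orbb => ui0; exact/eqP/ui0.
Qed.

HB.instance Definition _ := @isDotProduct.Build R euclidean euclidean_dot
  euclidean_dot_gt0.

Let dot : {dot euclidean for @idfun R} := euclidean_dot.

Definition euclidean_norm (u : euclidean) : R := Num.sqrt (euclidean_dot u u).

Lemma euclidean_normD u v :
  euclidean_norm (u + v) <= euclidean_norm u + euclidean_norm v.
Proof.
rewrite -(@ler_pXn2r _ 2) ?nnegrE ?addr_ge0 ?sqrtr_ge0// sqrrD.
rewrite !sqr_sqrtr ?(dot_ge0 dot)//.
rewrite (dotDl dot) !(dotDr dot) (dotC dot v u) -/(euclidean_dot u v).
rewrite [leLHS](_ : _ = euclidean_dot u u + euclidean_dot u v *+ 2 +
  euclidean_dot v v); last by rewrite /dot/=; ring.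
rewrite lerD2r lerD2l lerMn2r/= (le_trans (ler_norm _))//.
rewrite -sqrtr_sqr /euclidean_norm -sqrtrM ?(dot_ge0 dot)// ler_wsqrtr//.
exact: (dot_cauchy_schwarz dot).
Qed.

Lemma euclidean_normZ a u : euclidean_norm (a *: u) = `|a| * euclidean_norm u.
Proof.
rewrite /euclidean_norm (dotZl dot) (dotZr dot) mulrA -expr2.
by rewrite sqrtrM ?sqr_ge0// sqrtr_sqr.
Qed.

Lemma euclidean_norm_eq0 u : euclidean_norm u = 0 -> u = 0.
Proof.
move=> /eqP; rewrite sqrtr_eq0 => u0; apply: (dot_eq0 dot).
by apply/eqP; rewrite eq_le u0 (dot_ge0 dot).
Qed.

HB.instance Definition _ := Lmodule_isNormed.Build R euclidean
  euclidean_normD euclidean_normZ euclidean_norm_eq0.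

Lemma euclidean_sqr_norm (u : euclidean) : `|u| ^+ 2 = euclidean_dot u u.
Proof. by rewrite /Num.norm/= sqr_sqrtr// (dot_ge0 dot). Qed.

Lemma coord_le_euclidean_norm (u : euclidean) i : `|u 0 i| <= `|u|.
Proof.
rewrite -sqrtr_sqr ler_wsqrtr// expr2 /euclidean_dot (bigD1 i)//= lerDl.
by apply: sumr_ge0 => j _; rewrite -expr2 sqr_ge0.
Qed.

Lemma euclidean_norm_le (u : euclidean) (e : R) : 0 <= e ->
  (forall i, `|u 0 i| <= e) -> `|u| <= n%:R * e.
Proof.
move=> e0 ue.
have n0 : (0 : R) <= n%:R by rewrite ler0n.
rewrite -(@ler_pXn2r _ 2) ?nnegrE ?mulr_ge0// euclidean_sqr_norm.
apply: (@le_trans _ _ (\sum_(i < n) e ^+ 2)).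
  apply: ler_sum => i _; rewrite -expr2 -real_normK ?num_real//.
  by rewrite lerXn2r ?nnegrE.
rewrite sumr_const card_ord exprMn -[leLHS]mulr_natl ler_wpM2r ?sqr_ge0//.
by rewrite -natrX ler_nat; case: (n) => // k; rewrite -mulnn leq_pmulr.
Qed.

(** Coordinates are 1-Lipschitz and hence send [F] to Cauchy filters; their limits form the limit
    vector, since the norm is at most [n] times the largest coordinate. *)
Lemma euclidean_complete (F : set_system euclidean) :
  ProperFilter F -> cauchy F -> cvg F.
Proof.
move=> FF /cauchyP Fc.
pose coord (i : 'I_n) (u : euclidean) : R := u 0 i.
have coord_cvg i : cvg (coord i @ F).
  apply: cauchy_cvg; apply: cauchy_exP => e e0; have [x xe] := Fc e e0.
  exists (coord i x); rewrite /nbhs/=; apply: filterS xe => y.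
  rewrite -!ball_normE/=; apply: le_lt_trans.
  have := coord_le_euclidean_norm (x - y) i.
  by rewrite mxE [X in _ + X]mxE.
pose l : euclidean := \row_i lim (coord i @ F).
apply/cvg_ex; exists l; apply/cvgrPdist_le => e e0.
(* Dividing by [n.+1] keeps the tolerance positive also for [n = 0]. *)
have d0 : 0 < e / n.+1%:R by rewrite divr_gt0 ?ltr0n.
have : \forall x \near F, forall i, `|l 0 i - coord i x| <= e / n.+1%:R.
  apply: filter_forall => i; rewrite mxE.
  by move: d0; move: (e / _); apply/cvgrPdist_le; exact: coord_cvg.
apply: filterS => x xl.
apply: (@le_trans _ _ (n%:R * (e / n.+1%:R))).
  apply: euclidean_norm_le; first exact: ltW.
  by move=> i; rewrite mxE [X in _ + X]mxE; exact: xl.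
by rewrite mulrCA ler_piMr ?(ltW e0)// ler_pdivrMr ?ltr0n// mul1r ler_nat.
Qed.

HB.instance Definition _ :=
  Uniform_isComplete.Build euclidean euclidean_complete.

Lemma euclidean_is_hilbert : is_hilbert euclidean.
Proof. by exists dot => u; exact: euclidean_sqr_norm. Qed.

End Euclidean.

(** * Discrete Poincare inequality for antiperiodic sequences *)

Section AntiperiodicPoincare.
Context {R : realType} {U : lmodType R} (ip : {dot U for @idfun R}).
Implicit Types (w g : nat -> U) (m : nat).

Lemma cosBD_sum (x y : R) : cos (x - y) + cos (x + y) = 2 * cos y * cos x.
Proof. rewrite cosB cosD; ring. Qed.

Lemma sinBD_sum (x y : R) : sin (x - y) + sin (x + y) = 2 * cos y * sin x.
Proof. rewrite sinB sinD; ring. Qed.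

(* Picone's argument with the positive solution [sin (j * pi / m)] of
   [phi (j + 1) + phi (j - 1) = 2 * cos (pi / m) * phi j]. *)
Lemma dirichlet_poincare w m : w 0%N = 0 -> w m = 0 ->
  \sum_(j < m) ip (w j) (w j.+1) <=
  cos (pi / m%:R) * \sum_(j < m) ip (w j) (w j).
Proof.
case: m => [|[|k]] w0 wm; first by rewrite !big_ord0 mulr0.
  by rewrite !big_ord1 w0 !dot0l mulr0.
set m := k.+2 in wm *; set c := cos _.
have m0 : (0 : R) < m%:R by rewrite ltr0n.
pose phi (j : nat) : R := sin (j%:R * (pi / m%:R)).
have phi_gt0 j : (0 < j < m)%N -> 0 < phi j.
  move=> /andP[j0 jm]; apply: sin_gt0_pi.
  rewrite mulr_gt0 ?ltr0n ?divr_gt0 ?pi_gt0//= mulrCA gtr_pMr ?pi_gt0//.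
  by rewrite ltr_pdivrMr// mul1r ltr_nat.
have phi_rec j : phi j + phi j.+2 = 2 * c * phi j.+1.
  rewrite /phi -sinBD_sum; congr (sin _ + sin _).
    by rewrite -(natr1 j); ring.
  by rewrite -(natr1 j.+1); ring.
have phi0 : phi 0%N = 0 by rewrite /phi mul0r sin0.
have phim : phi m = 0 by rewrite /phi mulrC divfK ?gt_eqF// sinpi.
(* From [n] to [n.+1] the gap between the two sides grows by the squared length of
   [phi n.+2 *: w n.+1 - phi n.+1 *: w n.+2], divided by [phi n.+1 * phi n.+2]. *)
have step n : (n.+1 < m)%N -> 2 * \sum_(j < n.+1) ip (w j) (w j.+1) <=
    2 * c * (\sum_(j < n.+1) ip (w j) (w j)) +
    phi n / phi n.+1 * ip (w n.+1) (w n.+1).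
  elim: n => [|n IHn] nm.
    by rewrite !big_ord1 w0 !dot0l phi0 !(mul0r, mulr0, addr0).
  rewrite (big_ord_recr n.+1)/= (big_ord_recr n.+1)/=.
  have /IHn {}IHn := ltnW nm.
  have p1 : 0 < phi n.+1 by apply: phi_gt0; rewrite /= ltnW.
  have p2 : 0 < phi n.+2 by apply: phi_gt0.
  have : 0 <= ip (phi n.+2 *: w n.+1 - phi n.+1 *: w n.+2)
      (phi n.+2 *: w n.+1 - phi n.+1 *: w n.+2) / (phi n.+1 * phi n.+2).
    by rewrite divr_ge0 ?dot_ge0// mulr_ge0// ltW.
  rewrite !(dotDl, dotDr, dotZl, dotZr, dotNl, dotNr).
  rewrite (dotC ip (w n.+2) (w n.+1)).
  have cE : 2 * c = (phi n + phi n.+2) / phi n.+1.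
    by rewrite phi_rec mulfK// gt_eqF.
  move: IHn; rewrite cE.
  move: (\sum_(_ < _) _) (\sum_(_ < _) _) => S1 S2 IHn H.
  rewrite -subr_ge0 in IHn; rewrite -subr_ge0.
  apply: le_trans (addr_ge0 IHn H) _; rewrite le_eqVlt; apply/orP; left.
  by apply/eqP; field; rewrite !gt_eqF.
rewrite -(ler_pM2l (_ : 0 < 2)) ?ltr0n// mulrA.
rewrite big_ord_recr/= (big_ord_recr k.+1)/= wm (dotC ip _ 0) dot0l addr0.
apply: le_trans (step k (ltnSn _)) _.
have pk : phi k.+1 != 0 by rewrite gt_eqF// phi_gt0/=.
(* As [phi] vanishes at [m = k.+2], the recurrence makes the boundary term exactly the missing last
   summand on the right. *)
have -> : phi k / phi k.+1 = 2 * c.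
  by apply: (mulIf pk); rewrite divfK// -phi_rec phim addr0.
by rewrite mulrDr.
Qed.

(** The constant is the least eigenvalue of minus the second difference under antiperiodic boundary
    conditions, with eigenvector [cos (j * pi / m)]. Subtracting the multiple of this cosine that
    agrees with [g] at 0 leaves a sequence vanishing at both ends. *)
Lemma antiperiodic_poincare g m : (0 < m)%N -> g m = - g 0%N ->
  2 * (1 - cos (pi / m%:R)) * \sum_(j < m) ip (g j) (g j) <=
  \sum_(j < m) ip (g j.+1 - g j) (g j.+1 - g j).
Proof.
move=> m_gt0 gm; set c := cos _.
have mE : m%:R * (pi / m%:R) = pi :> R.
  by rewrite mulrC divfK// pnatr_eq0 -lt0n.
pose C (x : R) := cos (x * (pi / m%:R)).
pose a := g 0%N; pose w j := g j - C j%:R *: a.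
have Crec (x : R) : C (x - 1) + C (x + 1) = 2 * c * C x.
  by rewrite /C /c -cosBD_sum; congr (cos _ + cos _); ring.
have C0 : C 0 = 1 by rewrite /C mul0r cos0.
have Cm : C m%:R = - 1 by rewrite /C mE cospi.
have w0 : w 0%N = 0 by rewrite /w C0 scale1r subrr.
have wm : w m = 0 by rewrite /w Cm gm scaleN1r opprK addNr.
have gE i : g i = w i + C i%:R *: a by rewrite /w subrK.
clearbody w.
pose P (j : nat) := C (j%:R - 1) * ip (w j) a
  + ip a a * C j%:R * C (j%:R - 1) / 2.
(* [j |-> C j *: a] satisfies the Euler-Lagrange equation of the quadratic
   form, so that subtracting it changes the form by a telescoping sum. *)
have termE j : c * ip (g j) (g j) - ip (g j) (g j.+1) =
    c * ip (w j) (w j) - ip (w j) (w j.+1) - (P j.+1 - P j).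
  rewrite (gE j) (gE j.+1) /P -natr1 addrK.
  rewrite !(dotDl, dotDr, dotZl, dotZr) (dotC ip a (w j)) (dotC ip a (w j.+1)).
  have -> : C (j%:R + 1) = 2 * c * C j%:R - C (j%:R - 1).
    by rewrite -Crec addrAC subrr add0r.
  by field.
(* Both values equal [c * ip a a / 2]. *)
have P0m : P 0%N = P m.
  rewrite /P w0 wm !dot0l C0 Cm.
  have -> : C (m%:R - 1) = - c.
    by rewrite /C mulrBl mul1r mE addrC cosDpi cosN.
  by rewrite /C sub0r mulN1r cosN -/c; field.
have key : \sum_(j < m) ip (g j) (g j.+1) <= c * \sum_(j < m) ip (g j) (g j).
  rewrite -subr_ge0 mulr_sumr -sumrB (eq_bigr _ (fun (j : 'I_m) _ => termE j)).
  rewrite sumrB -(big_mkord xpredT (fun j => P j.+1 - P j)).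
  rewrite telescope_sumr// P0m subrr subr0 sumrB -mulr_sumr subr_ge0.
  exact: dirichlet_poincare.
have shift : \sum_(j < m) ip (g j.+1) (g j.+1) = \sum_(j < m) ip (g j) (g j).
  apply: (@addrI _ (ip (g 0%N) (g 0%N))).
  rewrite -(big_ord_recl m (fun j => ip (g j) (g j)))/=.
  by rewrite big_ord_recr/= gm dotNl dotNr opprK addrC.
have -> : \sum_(j < m) ip (g j.+1 - g j) (g j.+1 - g j) =
    \sum_(j < m) ip (g j.+1) (g j.+1) + \sum_(j < m) ip (g j) (g j)
    - 2 * \sum_(j < m) ip (g j) (g j.+1).
  rewrite mulr_sumr -big_split/= -sumrB; apply: eq_bigr => j _.
  by rewrite !(dotDl, dotDr, dotNl, dotNr) (dotC ip (g j.+1)); ring.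
rewrite shift; move: key; move: (\sum_(_ < _) _) (\sum_(_ < _) _) => x y; nra.
Qed.

End AntiperiodicPoincare.

(** * The Dirichlet kernel and comparison of [sin (n * s)] with [sin s] *)

Section DirichletKernel.
Context {R : realType}.
Implicit Types (n : nat) (s t x y : R).

Lemma cos_norm x : cos `|x| = cos x.
Proof. by have [] := ger0P x; rewrite ?cosN. Qed.

Lemma ler_cos_pi x y : `|x| <= `|y| -> `|y| <= pi -> cos y <= cos x.
Proof.
move=> xy ypi; rewrite -(cos_norm x) -(cos_norm y).
have [->//|neq] := eqVneq `|x| `|y|.
by rewrite ltW// ltr_cos ?in_itv/= ?normr_ge0 ?(le_trans xy)// lt_neqAle neq.
Qed.

Lemma oneBcos_double s : 1 - cos (2 * s) = 2 * sin s ^+ 2.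
Proof. by rewrite mulr_natl cos_mulr2n sin2cos2; ring. Qed.

(** The quotient [sin (n * s) / sin s], with frequencies 1 - n, 3 - n, ..., n - 1; as a sum it can
    be bounded term by term, also at zeros of the sine. *)
Definition dirichlet_kernel n s : R :=
  \sum_(k < n) cos ((k.*2.+1%:R - n%:R) * s).

(** Each cosine times [2 * sin s] is a difference of consecutive sines, and the sum telescopes from
    [- sin (n * s)] to [sin (n * s)]. *)
Lemma sin_dirichlet n s : sin (n%:R * s) = sin s * dirichlet_kernel n s.
Proof.
pose f (k : nat) := sin ((k.*2%:R - n%:R) * s).
have fE k : f k.+1 - f k = 2 * (sin s * cos ((k.*2.+1%:R - n%:R) * s)).
  have -> : f k.+1 = sin ((k.*2.+1%:R - n%:R) * s + s).
    by rewrite /f doubleS -(natr1 k.*2.+1); congr sin; ring.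
  have -> : f k = sin ((k.*2.+1%:R - n%:R) * s - s).
    by rewrite /f -(natr1 k.*2); congr sin; ring.
  by rewrite sinD sinB; ring.
have : \sum_(0 <= k < n) (f k.+1 - f k) = f n - f 0%N by rewrite telescope_sumr.
rewrite (eq_bigr _ (fun k _ => fE k)) -!mulr_sumr big_mkord.
rewrite -/(dirichlet_kernel n s) /f -addnn natrD addrK sub0r mulNr sinN => H.
by apply: (mulfI (_ : 2 != 0)); rewrite ?pnatr_eq0// H; ring.
Qed.

Lemma dirichlet_freq_le n k : (k < n)%N ->
  `|k.*2.+1%:R - n%:R| <= n%:R :> R.
Proof.
move=> kn; rewrite ler_norml lerBlDr -natrD ler_nat lerBrDr addNr ler0n/=.
by rewrite addnn ltn_double.
Qed.

Lemma dirichlet_kernel_le n s : `|dirichlet_kernel n s| <= n%:R.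
Proof.
rewrite (le_trans (ler_norm_sum _ _ _))//.
rewrite (le_trans (ler_sum _ (fun (k : 'I_n) _ => cos_max _)))//.
by rewrite sumr_const card_ord.
Qed.

Lemma dirichlet_freqM_le n k s : (k < n)%N ->
  `|(k.*2.+1%:R - n%:R) * s| <= n%:R * `|s|.
Proof. by move=> kn; rewrite normrM ler_wpM2r// dirichlet_freq_le. Qed.

(** All arguments stay in [- pi, pi], where the cosine decreases in the absolute value. *)
Lemma ler_dirichlet_kernel n s t : `|s| <= `|t| -> n%:R * `|t| <= pi ->
  dirichlet_kernel n t <= dirichlet_kernel n s.
Proof.
move=> st tpi; apply: ler_sum => k _; apply: ler_cos_pi.
  by rewrite !normrM ler_wpM2l.
by rewrite (le_trans _ tpi)// dirichlet_freqM_le.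
Qed.

(** No frequency exceeds [n] in absolute value, so [cos (n * s)] bounds every summand from below. *)
Lemma dirichlet_kernel_ge n s : 0 <= s -> n%:R * s <= pi ->
  n%:R * cos (n%:R * s) <= dirichlet_kernel n s.
Proof.
move=> s0 spi.
have nsE : `|n%:R * s| = n%:R * s by rewrite ger0_norm// mulr_ge0.
rewrite mulr_natl -[X in _ *+ X]card_ord -sumr_const; apply: ler_sum => k _.
apply: ler_cos_pi; rewrite ?nsE// -[in leRHS](ger0_norm s0).
exact: dirichlet_freqM_le.
Qed.

Lemma sin_mul_ge n s : 0 <= s -> s <= pi -> n%:R * s <= pi ->
  n%:R * cos (n%:R * s) * sin s <= sin (n%:R * s).
Proof.
move=> s0 spi nspi; rewrite sin_dirichlet mulrC ler_wpM2l//.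
  by rewrite sin_ge0_pi// s0.
exact: dirichlet_kernel_ge.
Qed.

(** Half angles turn this into [|sin (n * s)| <= n * |sin s|]. It makes the cone embedding
    1-Lipschitz. *)
Lemma oneBcos_mul_le n t : 1 - cos (n%:R * t) <= n%:R ^+ 2 * (1 - cos t).
Proof.
have -> : t = 2 * (t / 2) by rewrite mulrCA divff ?mulr1 ?pnatr_eq0.
set s := t / 2; rewrite (mulrCA n%:R) !oneBcos_double [leRHS]mulrCA ler_wpM2l//.
rewrite sin_dirichlet exprMn mulrC ler_wpM2r ?sqr_ge0//.
rewrite -[leLHS]real_normK ?num_real// lerXn2r ?nnegrE//.
exact: dirichlet_kernel_le.
Qed.

(** With [s = t / 2] and [a = pi / (2 * n)] it suffices that [sin a * dirichlet_kernel n s] is at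
    least 1. At [s = a] it equals [sin (n * a) = 1], and the kernel is no smaller for [|s| <= a]. *)
Lemma oneBcos_le_mul n t : (0 < n)%N -> `|t| <= pi / n%:R ->
  1 - cos t <= sin (pi / (2 * n%:R)) ^+ 2 * (1 - cos (n%:R * t)).
Proof.
move=> n0 tn.
have -> : t = 2 * (t / 2) by rewrite mulrCA divff ?mulr1 ?pnatr_eq0.
set s := t / 2; rewrite (mulrCA n%:R) !oneBcos_double.
rewrite [leRHS]mulrCA ler_wpM2l// (sin_dirichlet n) exprMn mulrCA.
rewrite ler_peMr ?sqr_ge0//.
rewrite -exprMn exprn_ege1//.
set a := pi / _.
have nR0 : (0 : R) < n%:R by rewrite ltr0n.
have a0 : 0 < a by rewrite divr_gt0 ?pi_gt0 ?mulr_gt0.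
have na : n%:R * a = pi / 2 by rewrite /a; field; rewrite gt_eqF.
have D1 : sin a * dirichlet_kernel n a = 1.
  by rewrite -sin_dirichlet na sin_pihalf.
have sa : 0 <= sin a.
  rewrite sin_ge0_pi// ltW//= /a ler_pdivrMr ?mulr_gt0// ler_peMr ?pi_ge0//.
  by rewrite -natrM ler1n muln_gt0 n0.
rewrite -D1 ler_wpM2l// ler_dirichlet_kernel//.
  rewrite (gtr0_norm a0) /s normrM (@ger0_norm _ 2^-1)// /a invfM mulrCA mulrC.
  by rewrite ler_wpM2l// mulrC.
by rewrite (gtr0_norm a0) na ler_pdivrMr// ler_peMr ?pi_ge0// ler1n.
Qed.

End DirichletKernel.

(** * Polar coordinates in the complex plane *)

Section Polar.
Context {R : realType}.
Implicit Types (rho sigma a b : R).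

Definition polar rho a : R[i] := Complex (rho * cos a) (rho * sin a).

Lemma polarM rho sigma a b :
  polar rho a * polar sigma b = polar (rho * sigma) (a + b).
Proof.
apply/eqP; rewrite eq_complex/= cosD sinD.
by apply/andP; split; apply/eqP; ring.
Qed.

Lemma polar10 : polar 1 0 = 1.
Proof. by rewrite /polar cos0 sin0 mulr1 mulr0. Qed.

Lemma polar1V a : (polar 1 a)^-1 = polar 1 (- a).
Proof.
have aN : polar 1 a * polar 1 (- a) = 1 by rewrite polarM mulr1 subrr polar10.
have a0 : polar 1 a != 0.
  by apply/eqP => a0; move/eqP: aN; rewrite a0 mul0r eq_sym oner_eq0.
by apply: (mulfI a0); rewrite aN mulfV.
Qed.

Lemma normc_ge0 (x : R[i]) : 0 <= normc x.
Proof. by case: x => a b /=; rewrite sqrtr_ge0. Qed.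

(** The law of cosines with the radial part split off, so that later estimates concern only
    [1 - cos (a - b)]. *)
Lemma sqr_normc_polarB rho sigma a b :
  normc (polar rho a - polar sigma b) ^+ 2 =
  (rho - sigma) ^+ 2 + 2 * (rho * sigma) * (1 - cos (a - b)).
Proof.
rewrite /= sqr_sqrtr ?addr_ge0 ?sqr_ge0// cosB.
have -> : (rho - sigma) ^+ 2 = rho ^+ 2 * (cos a ^+ 2 + sin a ^+ 2) +
    sigma ^+ 2 * (cos b ^+ 2 + sin b ^+ 2) - 2 * (rho * sigma).
  by rewrite !cos2Dsin2; ring.
by ring.
Qed.

Lemma polar_arg (x : R[i]) : exists a, x = polar (normc x) a.
Proof.
case: x => u v; set rho := normc _.
have rhoE : rho ^+ 2 = u ^+ 2 + v ^+ 2.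
  by rewrite /rho/= sqr_sqrtr// addr_ge0// sqr_ge0.
have [rho0|rho_neq0] := eqVneq rho 0.
  exists 0; rewrite rho0 /polar !mul0r; exact: (eq0_normc rho0).
have rho_gt0 : 0 < rho by rewrite lt_neqAle eq_sym rho_neq0 normc_ge0.
set c := u / rho.
have c1 : -1 <= c <= 1.
  rewrite -ler_norml -(@expr_le1 _ 2)// real_normK ?num_real//.
  rewrite expr_div_n rhoE ler_pdivrMr -rhoE ?exprn_gt0// mul1r rhoE.
  by rewrite lerDl sqr_ge0.
have uE : rho * cos (acos c) = u by rewrite acosK// mulrC divfK.
have vE : rho * sin (acos c) = `|v|.
  rewrite sin_acos// -[rho](gtr0_norm rho_gt0) -sqrtr_sqr -sqrtrM ?sqr_ge0//.
  rewrite mulrBr mulr1 expr_div_n mulrC divfK ?expf_neq0// rhoE addrC addKr.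
  exact: sqrtr_sqr.
(* The angle [acos c] has a nonnegative sine; a negative [v] is reached by reversing it. *)
have [v0|v0] := ger0P v.
  by exists (acos c); rewrite /polar uE vE ger0_norm.
by exists (- acos c); rewrite /polar cosN sinN uE mulrN vE ltr0_norm// opprK.
Qed.

End Polar.

(** * Orbit distances in polar coordinates *)

Section OrbitDistance.
Context {R : realType} {r : nat} (r_gt0 : (0 < r)%N).
Implicit Types (rho sigma a b : R).

Lemma rotation_group_polar (k : int) :
  @rotation_group R r (polar 1 (k%:~R * (2 * pi / r%:R))).
Proof.
exists k => //; case: k => n.
  by rewrite -exprnP zetaX /polar !mul1r.
by rewrite NegzE -exprnN zetaX intrN mulNr -polar1V /polar !mul1r.
Qed.

Lemma zetaX_order : zeta R r ^+ r = 1.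
Proof.
rewrite zetaX mulrC divfK ?pnatr_eq0 -?lt0n//.
by rewrite mulr_natl cos2pi sin2pi.
Qed.

Lemma rotation_groupP (g : R[i]) : @rotation_group R r g ->
  exists2 n, (n < r)%N & g = polar 1 (n%:R * (2 * pi / r%:R)).
Proof.
have [m mP] := rot_finite R r; move=> /mP[k ->].
exists (k %% r)%N; first by rewrite ltn_mod.
by rewrite -(expr_mod k zetaX_order) zetaX /polar !mul1r.
Qed.

Let rR : (r%:R : R) != 0.
Proof. by rewrite pnatr_eq0 -lt0n. Qed.

Lemma cos_mulr_rot (t : R) (k : int) :
  cos (r%:R * (k%:~R * (2 * pi / r%:R) + t)) = cos (r%:R * t).
Proof.
rewrite mulrDr (_ : r%:R * (k%:~R * _) = (pi *+ 2) * k%:~R); last by field.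
rewrite addrC; case: k => n.
  by rewrite mulr_natr (periodicn (@cosD2pi R)).
rewrite NegzE intrN mulrN mulr_natr.
by rewrite -[LHS](periodicn (@cosD2pi R) n.+1) subrK.
Qed.

(** Some rotation in the group brings the angle difference into [- pi / r, pi / r], where
    [oneBcos_le_mul] applies, and leaves [cos (r * (a - b))] unchanged. *)
Lemma orbit_dist_sqr_le rho sigma a b : 0 <= rho -> 0 <= sigma ->
  orbit_dist (orbit_class r (polar rho a)) (orbit_class r (polar sigma b)) ^+ 2
  <= (rho - sigma) ^+ 2 + 2 * (rho * sigma) *
     (sin (pi / (2 * r%:R)) ^+ 2 * (1 - cos (r%:R * (a - b)))).
Proof.
move=> rho0 sigma0.
set T : R := 2 * pi / r%:R.
have T0 : 0 < T by rewrite divr_gt0 ?mulr_gt0 ?pi_gt0 ?ltr0n.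
(* Here [- k] is [(a - b) / T] rounded to a nearest integer. *)
pose k := - Num.floor ((a - b) / T + 1 / 2).
set t := k%:~R * T + (a - b).
have tr : `|t| <= pi / r%:R.
  have /andP[k1 k2] := real_floor_itv (num_real ((a - b) / T + 1 / 2)).
  have abE : a - b = (a - b) / T * T by rewrite divfK// gt_eqF.
  rewrite /t /k; move: k1 k2; rewrite intrN intrD.
  set q := (Num.floor _)%:~R; rewrite abE mulfK ?gt_eqF//.
  set z := (a - b) / T => k1 k2.
  have -> : pi / r%:R = T / 2 by rewrite /T; field.
  by rewrite ler_norml; apply/andP; split; nra.
have Gg := rotation_group_polar k.
have d0 (x y : R[i]) : 0 <= orbit_dist (orbit_class r x) (orbit_class r y).
  by have [g _ [-> _]] := orbit_dist_min r x y; exact: normc_ge0.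
apply: (@le_trans _ _
  (normc (polar 1 (k%:~R * T) * polar rho a - polar sigma b) ^+ 2)).
  rewrite lerXn2r ?nnegrE ?normc_ge0 ?d0//.
  exact: orbit_dist_le Gg.
rewrite polarM mul1r sqr_normc_polarB lerD2l ler_wpM2l ?mulr_ge0//.
rewrite -addrA -/t -(cos_mulr_rot (a - b) k) -/T -/t.
exact: oneBcos_le_mul.
Qed.

(** The left side is invariant under the group, so [oneBcos_mul_le] can be applied after the
    minimizing rotation. *)
Lemma orbit_dist_sqr_ge rho sigma a b : 0 <= rho -> 0 <= sigma ->
  (rho - sigma) ^+ 2 +
    2 * (rho * sigma) * ((1 - cos (r%:R * (a - b))) / r%:R ^+ 2) <=
  orbit_dist (orbit_class r (polar rho a)) (orbit_class r (polar sigma b)) ^+ 2.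
Proof.
move=> rho0 sigma0.
have [g /rotation_groupP[n _ ->] [-> _]] :=
  orbit_dist_min r (polar rho a) (polar sigma b).
rewrite polarM mul1r sqr_normc_polarB lerD2l ler_wpM2l ?mulr_ge0//.
rewrite -addrA ler_pdivrMr ?exprn_gt0 ?ltr0n// [leRHS]mulrC.
have := cos_mulr_rot (a - b) n; rewrite -pmulrn => <-.
exact: oneBcos_mul_le.
Qed.

(** Every rotation leaves an angle difference that is an odd multiple of [pi / r], hence at least
    [pi / r] away from the multiples of [2 * pi]. *)
Lemma orbit_dist_antipode a :
  2 * sin (pi / (2 * r%:R)) <=
  orbit_dist (orbit_class r (polar 1 a))
    (orbit_class r (polar 1 (a + pi / r%:R))).
Proof.
have [g /rotation_groupP[n nr ->] [-> _]] :=
  orbit_dist_min r (polar 1 a) (polar 1 (a + pi / r%:R)).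
set theta : R := pi / (2 * r%:R).
have rR0 : (0 : R) < r%:R by rewrite ltr0n.
have piE : pi = 2 * r%:R * theta :> R by rewrite /theta; field.
have th0 : 0 < theta by rewrite divr_gt0 ?pi_gt0// mulr_gt0.
rewrite -(@ler_pXn2r _ 2) ?nnegrE ?normc_ge0//; last first.
  rewrite mulr_ge0// sin_ge0_pi// (ltW th0)/= piE -[leLHS]mul1r ler_pM2r//.
  by rewrite -natrM ler1n muln_gt0.
rewrite polarM mulr1 sqr_normc_polarB subrr expr0n add0r !mulr1.
rewrite exprMn.
have -> : (2 : R) ^+ 2 * sin theta ^+ 2 = 2 * (1 - cos (2 * theta)).
  by rewrite oneBcos_double; ring.
rewrite ler_pM2l// lerB//.
set t := _ - _.
have tE : t = (n.*2%:R - 1) * (2 * theta).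
  by rewrite /t /theta -addnn natrD; field.
(* For [n = 0] the angle is [- (2 * theta)]; otherwise it lies between [2 * theta] and
   [2 * pi - 2 * theta], and is reflected to [2 * pi - t] when it exceeds [pi]. *)
case: n nr t tE => [|n] nr t tE.
  by rewrite tE sub0r mulN1r cosN.
have nr' : (n.+1.*2%:R : R) <= 2 * r%:R - 2.
  by rewrite lerBrDr -!natrM -natrD ler_nat mul2n addn2 -doubleS leq_double.
have n1 : (2 : R) <= n.+1.*2%:R by rewrite ler_nat doubleS.
have tth : 2 * theta <= t by rewrite tE; nra.
have tth' : 2 * theta <= 2 * pi - t by rewrite piE tE; nra.
have [tpi|pit] := lerP t pi.
  by apply: ler_cos_pi; rewrite !ger0_norm; lra.
rewrite -(cosN t) -(cosD2pi (- t)) -[pi *+ 2]mulr_natl; apply: ler_cos_pi;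
  by rewrite !ger0_norm; lra.
Qed.

End OrbitDistance.

(** * Upper bound: distortion of the cone embedding *)

Section Distortion.
Context {R : realType} {r : nat} (r_gt0 : (0 < r)%N).

Let rR0 : (0 : R) < r%:R. Proof. by rewrite ltr0n. Qed.

Lemma orbit_dist_ge0 (A B : orbit_space R r) : 0 <= orbit_dist A B.
Proof. exact: (@mdist_ge0 R (orbit_space R r)). Qed.

Lemma sin_pi_double_gt0 : 0 < sin (pi / (2 * r%:R)) :> R.
Proof.
apply: sin_gt0_pi; rewrite divr_gt0 ?pi_gt0 ?mulr_gt0//=.
by rewrite ltr_pdivrMr ?mulr_gt0// ltr_pMr ?pi_gt0// -natrM ltr1n leq_pmulr.
Qed.

(** At [t = pi / (2 * r)] one has [sin (r * t) = 1], while the Dirichlet kernel is at most [r]. *)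
Lemma distortion_ge1 : 1 <= r%:R * sin (pi / (2 * r%:R)) :> R.
Proof.
set t := pi / _.
have rt : r%:R * t = pi / 2 by rewrite /t; field; rewrite gt_eqF.
rewrite -[leLHS](sin_pihalf R) -rt sin_dirichlet [leLHS]mulrC.
rewrite ler_wpM2r ?(ltW sin_pi_double_gt0)//.
exact: le_trans (ler_norm _) (dirichlet_kernel_le _ _).
Qed.

Definition arg (x : R[i]) : R := sval (cid (polar_arg x)).

Lemma polar_normc_arg x : polar (normc x) (arg x) = x.
Proof. by rewrite /arg; case: cid. Qed.

(** The height factor makes every ray isometric. The factor [r] on the angle makes the value
    independent of the representative. *)
Definition cone_embedding (A : orbit_space R r) : @euclidean R 3 :=
  let rho := normc (orbit_repr A) in
  let t := r%:R * arg (orbit_repr A) in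
  \row_(i < 3) [:: rho / r%:R * cos t; rho / r%:R * sin t;
                   rho * Num.sqrt (1 - r%:R ^- 2)]`_i.

(** The first two coordinates give the law of cosines with radii divided by [r]; the third restores
    the coefficient 1 of the radial term. The result is the lower bound in [orbit_dist_sqr_ge]. *)
Lemma cone_embedding_sqr_dist A B :
  let rho := normc (orbit_repr A) in let sigma := normc (orbit_repr B) in
  let a := arg (orbit_repr A) in let b := arg (orbit_repr B) in
  `|cone_embedding A - cone_embedding B| ^+ 2 = (rho - sigma) ^+ 2 +
    2 * (rho * sigma) * ((1 - cos (r%:R * (a - b))) / r%:R ^+ 2).
Proof.
move=> rho sigma a b; rewrite euclidean_sqr_norm /euclidean_dot.
rewrite !big_ord_recr big_ord0 !mxE/= add0r -/rho -/sigma -/a -/b.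
have sq : Num.sqrt (1 - r%:R ^- 2) ^+ 2 = 1 - r%:R ^- 2 :> R.
  rewrite sqr_sqrtr// subr_ge0 invf_le1 ?exprn_gt0//.
  by rewrite exprn_ege1// ler1n.
rewrite (mulrBr _ a) cosB; move: (cos2Dsin2 (r%:R * a)) (cos2Dsin2 (r%:R * b)).
move: (cos (_ * a)) (cos (_ * b)) (sin (_ * a)) (sin (_ * b)).
move=> ca cb sa sb Ha Hb.
rewrite -!expr2 -mulrBl exprMn sq.
have -> : (rho / r%:R * ca - sigma / r%:R * cb) ^+ 2 +
    (rho / r%:R * sa - sigma / r%:R * sb) ^+ 2 =
    (rho ^+ 2 * (ca ^+ 2 + sa ^+ 2) + sigma ^+ 2 * (cb ^+ 2 + sb ^+ 2)
     - 2 * rho * sigma * (ca * cb + sa * sb)) / r%:R ^+ 2.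
  by field; rewrite gt_eqF.
by rewrite Ha Hb; field; rewrite gt_eqF.
Qed.

Lemma orbit_space_embeds :
  embeds_with_distortion (orbit_space R r) (r%:R * sin (pi / (2 * r%:R))).
Proof.
set c := _ * _.
have c1 : 1 <= c by exact: distortion_ge1.
have c0 : 0 < c by rewrite (lt_le_trans ltr01).
exists (@euclidean R 3); split; first exact: euclidean_is_hilbert.
(* With [alpha] the inverse of [c], the upper bound says that the map is 1-Lipschitz. *)
exists cone_embedding, c^-1; rewrite invr_gt0; split=> // A B.
rewrite mulfV ?gt_eqF// mul1r -[mdist A B]/(orbit_dist A B).
have classE C : orbit_class r (polar (normc (orbit_repr C))
    (arg (orbit_repr C))) = C by rewrite polar_normc_arg orbit_reprK.
have d2_le := orbit_dist_sqr_le r_gt0 _ _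
  (arg (orbit_repr A)) (arg (orbit_repr B))
  (normc_ge0 (orbit_repr A)) (normc_ge0 (orbit_repr B)).
have d2_ge := orbit_dist_sqr_ge r_gt0 _ _
  (arg (orbit_repr A)) (arg (orbit_repr B))
  (normc_ge0 (orbit_repr A)) (normc_ge0 (orbit_repr B)).
rewrite !classE -cone_embedding_sqr_dist in d2_le d2_ge.
rewrite ler_pdivrMl//; split; last first.
  by rewrite -(@ler_pXn2r _ 2) ?nnegrE ?orbit_dist_ge0.
have cN0 : 0 <= c * `|cone_embedding A - cone_embedding B|.
  by rewrite mulr_ge0// ltW.
rewrite -(@ler_pXn2r _ 2) ?nnegrE ?orbit_dist_ge0//.
rewrite [leRHS]exprMn cone_embedding_sqr_dist.
(* Radial terms compare by [1 <= c]; angular terms agree, since [c ^ 2 / r ^ 2] is the squared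
   sine. *)
apply: le_trans d2_le _; rewrite [leRHS]mulrDr lerD//.
  by rewrite ler_peMl ?sqr_ge0// exprn_ege1.
rewrite le_eqVlt; apply/orP; left; apply/eqP.
by rewrite /c exprMn; field; rewrite gt_eqF.
Qed.

(** * Lower bound: equally spaced points on the unit circle of the cone *)

Lemma orbit_dist_rotate (a t : R) :
  orbit_dist (orbit_class r (polar 1 a)) (orbit_class r (polar 1 (a + t)))
  <= 2 * `|sin (t / 2)|.
Proof.
apply: (le_trans (orbit_dist_le _ _ (@rot1 R r))).
rewrite mul1r -(@ler_pXn2r _ 2) ?nnegrE ?normc_ge0 ?mulr_ge0//.
rewrite sqr_normc_polarB subrr expr0n add0r !mulr1.
have -> : a - (a + t) = - (2 * (t / 2)) by field.
rewrite cosN oneBcos_double exprMn real_normK ?num_real//.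
by rewrite le_eqVlt; apply/orP; left; apply/eqP; ring.
Qed.

Lemma distortion_ge_cos c m : (0 < m)%N -> 1 <= c ->
  embeds_with_distortion (orbit_space R r) c ->
  r%:R * sin (pi / (2 * r%:R)) * cos (pi / (2 * m%:R)) <= c.
Proof.
move=> m_gt0 c1 [H [[ip ipE] [f [alpha [alpha0 fP]]]]].
have mR0 : (0 : R) < m%:R by rewrite ltr0n.
have c0 : 0 < c by rewrite (lt_le_trans ltr01).
set S := sin (pi / (2 * r%:R)).
(* The circle has length [2 * pi / r] and closes up after [2 * m] steps; [2 * s] is the chord of one
   step. *)
pose step : R := pi / (m%:R * r%:R).
pose x := step / 2; pose s := sin x.
have rx : r%:R * x = pi / (2 * m%:R).
  by rewrite /x /step; field; rewrite !gt_eqF.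
have x0 : 0 < x by rewrite !divr_gt0 ?pi_gt0// mulr_gt0.
have xpi : x < pi.
  rewrite /x /step -mulrA -invfM gtr_pMr ?pi_gt0// invf_lt1 ?mulr_gt0//.
  by rewrite -!natrM ltr1n leq_pmull// muln_gt0 m_gt0.
have s0 : 0 < s by rewrite sin_gt0_pi// x0.
pose F j := f (orbit_class r (polar 1 (j%:R * step))).
have distE (A B : orbit_space R r) : mdist A B = orbit_dist A B by [].
have F_step j : `|F j.+1 - F j| <= c * alpha * (2 * s).
  rewrite distrC; have [_ le1] := fP (orbit_class r (polar 1 (j%:R * step)))
    (orbit_class r (polar 1 (j.+1%:R * step))).
  apply: le_trans le1 _; rewrite ler_pM2l ?mulr_gt0// distE.
  rewrite -natr1 mulrDl mul1r (le_trans (orbit_dist_rotate _ _))//.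
  by rewrite -/x ger0_norm// ltW.
have F_antipode j : alpha * (2 * S) <= `|F (j + m)%N - F j|.
  rewrite distrC; have [le1 _] := fP (orbit_class r (polar 1 (j%:R * step)))
    (orbit_class r (polar 1 ((j + m)%:R * step))).
  apply: le_trans le1; rewrite ler_pM2l// distE (natrD _ j) (mulrDl j%:R).
  have -> : m%:R * step = pi / r%:R by rewrite /step; field; rewrite !gt_eqF.
  exact: orbit_dist_antipode.
have F_period : F (m + m)%N = F 0%N.
  rewrite /F; congr f; apply: esym; apply/orbit_classP.
  exists (polar 1 (1%:~R * (2 * pi / r%:R))); first exact: rotation_group_polar.
  rewrite polarM mul1r mul0r addr0; congr polar.
  by rewrite natrD /step; field; rewrite !gt_eqF.
pose g j := F (j + m)%N - F j.
have gm : g m = - g 0%N by rewrite /g F_period add0n opprB.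
have g_ge j : (alpha * (2 * S)) ^+ 2 <= ip (g j) (g j).
  rewrite -ipE lerXn2r ?nnegrE// ?F_antipode//.
  by rewrite mulr_ge0 ?(ltW alpha0)// mulr_ge0// ltW// sin_pi_double_gt0.
have g_le j : ip (g j.+1 - g j) (g j.+1 - g j) <= (c * alpha * (4 * s)) ^+ 2.
  rewrite -ipE lerXn2r ?nnegrE// ?mulr_ge0 ?(ltW alpha0) ?(ltW s0) ?(ltW c0)//.
  have -> : g j.+1 - g j = (F (j + m).+1 - F (j + m)%N) - (F j.+1 - F j).
    by rewrite /g addSn !opprB addrACA [RHS]addrACA [- F j.+1 + _]addrC.
  rewrite (le_trans (ler_normB _ _))//.
  apply: (le_trans (lerD (F_step _) (F_step _))).
  by rewrite le_eqVlt; apply/orP; left; apply/eqP; ring.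
have := antiperiodic_poincare ip _ _ m_gt0 gm.
have -> : pi / m%:R = 2 * (pi / (2 * m%:R)) :> R.
  by field; rewrite gt_eqF.
rewrite oneBcos_double; set T := sin _.
(* Since [T = sin (r * x)] and [s = sin x], this is the lower bound on the Dirichlet kernel at
   [x]. *)
have T_ge : r%:R * cos (pi / (2 * m%:R)) * s <= T.
  rewrite /T -rx; apply: sin_mul_ge; rewrite ?ltW// rx.
  by rewrite ltr_pdivrMr ?mulr_gt0// ltr_pMr ?pi_gt0// -natrM ltr1n leq_pmulr.
have T0 : 0 <= T.
  rewrite /T -rx sin_ge0_pi// mulr_ge0 ?(ltW x0) ?ler0n//= rx.
  rewrite ltW// ltr_pdivrMr ?mulr_gt0// ltr_pMr ?pi_gt0//.
  by rewrite -natrM ltr1n leq_pmulr.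
have S0 : 0 < S by exact: sin_pi_double_gt0.
move=> poincare.
(* After summing [g_ge] and [g_le] over [m] indices, the common factors cancel and leave
   [T * S <= c * s]. *)
have {poincare} : 2 * (2 * T ^+ 2) * (m%:R * (alpha * (2 * S)) ^+ 2) <=
    m%:R * (c * alpha * (4 * s)) ^+ 2.
  apply: (le_trans (le_trans _ poincare)).
    rewrite ler_wpM2l ?mulr_ge0 ?sqr_ge0//.
    rewrite mulr_natl -[X in _ *+ X]card_ord -sumr_const.
    by apply: ler_sum => j _; exact: g_ge.
  rewrite mulr_natl -[X in _ *+ X]card_ord -sumr_const.
  by apply: ler_sum => j _; exact: g_le.
have -> : 2 * (2 * T ^+ 2) * (m%:R * (alpha * (2 * S)) ^+ 2) =
  16 * alpha ^+ 2 * m%:R * (T * S) ^+ 2 by ring.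
have -> : m%:R * (c * alpha * (4 * s)) ^+ 2 =
  16 * alpha ^+ 2 * m%:R * (c * s) ^+ 2 by ring.
rewrite ler_pM2l ?mulr_gt0 ?exprn_gt0//.
rewrite ler_pXn2r ?nnegrE ?mulr_ge0 ?(ltW S0) ?(ltW c0) ?(ltW s0)//.
move=> TS; rewrite -(ler_pM2r s0); apply: le_trans TS.
rewrite [leLHS](_ : _ = r%:R * cos (pi / (2 * m%:R)) * s * S); last by ring.
by rewrite ler_pM2r.
Qed.

(** The cosine factor tends to 1 as the number of points grows; the index [m.+1] keeps that number
    positive. *)
Lemma distortion_ge c : 1 <= c -> embeds_with_distortion (orbit_space R r) c ->
  r%:R * sin (pi / (2 * r%:R)) <= c.
Proof.
move=> c1 fc; set L := _ * _.
have half_cvg : pi / 2 * m.+1%:R^-1 @[m --> \oo] --> (pi / 2 * 0 : R).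
  by apply: cvgMr; exact: cvg_harmonic.
have : L * cos (pi / 2 * m.+1%:R^-1) @[m --> \oo] -->
    (L * cos (pi / 2 * 0) : R).
  by apply: cvgMr; apply: continuous_cvg half_cvg; exact: continuous_cos.
rewrite mulr0 cos0 mulr1 => /cvgr_to_le; apply; near=> m.
by rewrite -mulrA -invfM; exact: distortion_ge_cos.
Unshelve. all: by end_near. Qed.

End Distortion.

Theorem corollary38 (R : realType) (r : nat) (hr : (0 < r)%N) :
  c2 (orbit_space R r) = (r%:R * sin (pi / (2 * r%:R)))%:E.
Proof.
apply/eqP; rewrite eq_le; apply/andP; split.
  apply: ereal_inf_lbound; exists (r%:R * sin (pi / (2 * r%:R))) => //.
  by split; [exact: distortion_ge1|exact: orbit_space_embeds].
apply: le_ereal_inf_tmp => _ [c [c1 fc] <-].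
by rewrite lee_fin; exact: distortion_ge.
Qed.
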